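(* \textsc{Broadcast Domination} (finding the minimum cost of a dominating broadcast) is solvable in linear time on single-sourced layered DAGs.
   Context: Digraphs are finite and assumed weakly connected. For vertices $u,v$, $d(u,v)$ is the length of a shortest directed path from $u$ to $v$ ($\infty$ if none). A dominating broadcast of $D$ is a function $f:V(D)\to\mathbb{N}$ such that for every vertex $v$ there is a vertex $t$ with $f(t)>0$ and $d(t,v)\le f(t)$; its cost is $\sum_v f(v)$. \textsc{Broadcast Domination}: given $D$ and $k$, decide whether $D$ has a dominating broadcast of cost at most $k$. A DAG $D$ is layered if $V(D)$ can be partitioned into $V_0,\dots,V_t$ such that vertices of $V_0$ have no in-neighbors, vertices of $V_t$ have no out-neighbors, and every arc goes from some $V_i$ to $V_{i+1}$. A single-sourced layered DAG is a layered DAG with only one source (vertex with no in-neighbor), i.e. $|V_0|=1$. *)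

(* Defs.v *)
From mathcomp Require Import all_boot.
Set Implicit Arguments.
Unset Strict Implicit.
Unset Printing Implicit Defensive.

(* Vertices are numbered so that a digraph can be fed to a machine. *)
Record digraph := Digraph { order : nat; arc : rel 'I_order }.

Section Digraphs.

Variable D : digraph.
Notation vertex := 'I_(order D).

Definition weakly_connected : Prop :=
  forall u v : vertex, connect (fun x y => arc x y || arc y x) u v.

Definition acyclic : Prop := forall c : seq vertex, cycle (@arc D) c -> c = [::].

Definition source (v : vertex) : bool := [forall u, ~~ arc u v].

Definition sink (v : vertex) : bool := [forall u, ~~ arc v u].

(* Injectivity makes the classes with distinct indices disjoint; [partition]
   makes them nonempty. *)
Definition layering (t : nat) (V_ : 'I_t.+1 -> {set vertex}) : Prop :=
  [/\ injective V_,
      partition [set V_ i | i : 'I_t.+1] [set: vertex],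
      {in V_ ord0, forall v, source v},
      {in V_ ord_max, forall v, sink v} &
      forall u v : vertex, arc u v ->
        exists i j : 'I_t.+1,
          [/\ u \in V_ i, v \in V_ j & j = i.+1 :> nat]].

Definition layered_dag : Prop :=
  acyclic /\ exists (t : nat) (V_ : 'I_t.+1 -> {set vertex}), layering V_.

(* Every vertex of the nonempty class V_0 is a source, so a single source
   forces #|V_0| = 1. *)
Definition single_sourced_layered_dag : Prop :=
  [/\ weakly_connected, layered_dag & #|[set v | source v]| = 1].

(* [is_distance u v d] : d(u, v) = d, with d finite; d(u, v) is infinite when
   no such d exists. *)
Definition is_distance (u v : vertex) (d : nat) : Prop :=
  (exists p : seq vertex, [/\ path (@arc D) u p, last u p = v & size p = d]) /\
  (forall p : seq vertex, path (@arc D) u p -> last u p = v -> d <= size p).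

Definition dominating_broadcast (f : {ffun vertex -> nat}) : Prop :=
  forall v : vertex, exists t : vertex,
    0 < f t /\ exists2 d, is_distance t v d & d <= f t.

Definition cost (f : {ffun vertex -> nat}) : nat := \sum_v f v.

(* Adjacency lists: the number of vertices, then for each vertex its out-degree
   followed by its out-neighbours, listed in any order. *)
Definition encodes_digraph (x : seq nat) : Prop :=
  exists2 adj : vertex -> seq vertex,
    forall u, uniq (adj u) /\ (forall v, (v \in adj u) = arc u v) &
    x = order D ::
        flatten [seq size (adj u) :: [seq val v | v <- adj u] | u <- enum vertex].

Lemma size_encoding (x : seq nat) :
  encodes_digraph x ->
  size x = (order D + #|[set a : vertex * vertex | arc a.1 a.2]|).+1.
Proof.
case=> adj adjP ->; rewrite /= size_flatten /shape -map_comp sumnE big_map.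
rewrite big_enum /=; congr _.+1.
under eq_bigr => u _ do rewrite size_map -add1n.
rewrite big_split /= sum_nat_const card_ord muln1; congr (_ + _).
rewrite -sum1dep_card -(pair_big_dep xpredT (fun u v => arc u v) (fun _ _ => 1)).
apply: eq_bigr => u _ /=; rewrite sum1_card.
by case: (adjP u) => /card_uniqP <- inE; apply: eq_card => v; rewrite inE.
Qed.

End Digraphs.

(* Word RAM with w-bit words: a program uses finitely many registers, accesses
   the memory only indirectly through them, and computes modulo 2 ^ w. *)
Inductive instruction :=
  | Const of nat & nat        (* Const i a   : r_i := a *)
  | Move of nat & nat         (* Move i j    : r_i := r_j *)
  | Add of nat & nat & nat    (* Add i j k   : r_i := r_j + r_k *)
  | Sub of nat & nat & nat    (* Sub i j k   : r_i := r_j - r_k *)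
  | Read of nat & nat         (* Read i j    : r_i := mem[r_j] *)
  | Write of nat & nat        (* Write i j   : mem[r_i] := r_j *)
  | Jump of nat               (* Jump l      : goto l *)
  | JumpLt of nat & nat & nat (* JumpLt i j l : if r_i < r_j then goto l *)
  | Halt.

Definition program := seq instruction.

Record state := State { pc : nat; reg : nat -> nat; mem : nat -> nat }.

Definition update (f : nat -> nat) (i a : nat) : nat -> nat :=
  fun j => if j == i then a else f j.

Definition fetch (p : program) (s : state) : instruction := nth Halt p (pc s).

Definition halted (p : program) (s : state) : bool :=
  if fetch p s is Halt then true else false.

Definition step (w : nat) (p : program) (s : state) : state :=
  let: State l r m := s in
  let set i a := State l.+1 (update r i (a %% 2 ^ w)) m in
  match fetch p s with
  | Const i a => set i a
  | Move i j => set i (r j)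
  | Add i j k => set i (r j + r k)
  | Sub i j k => set i (r j + (2 ^ w - r k))
  | Read i j => set i (m (r j))
  | Write i j => State l.+1 r (update m (r i) (r j))
  | Jump l' => State l' r m
  | JumpLt i j l' => State (if r i < r j then l' else l.+1) r m
  | Halt => s
  end.

Definition init (x : seq nat) : state := State 0 (fun=> 0) (nth 0 x).

(* The output is the content of register 0 upon halting. *)
Definition outputs (w : nat) (p : program) (x : seq nat) (T out : nat) : Prop :=
  exists2 t, t <= T &
    let s := iter t (step w p) (init x) in halted p s /\ reg s 0 = out.

Record problem := Problem {
  instance : Type;
  encodes : instance -> seq nat -> Prop;
  is_answer : instance -> nat -> Prop }.

(* Words must have at least c * log2 N bits, where N exceeds both the length of
   the input and the numbers in it; the same program works for every such word
   length, in particular for words of O(log N) bits. *)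
Definition linear_time_solvable_on (P : problem) (C : instance P -> Prop) :
    Prop :=
  exists (p : program) (c : nat),
    forall (i : instance P) (x : seq nat) (w : nat),
      C i -> encodes i x ->
      (size x + \max_(a <- x) a).+1 ^ c <= 2 ^ w ->
      exists2 out, outputs w p x (c * size x) out & is_answer i out.

Definition broadcast_domination : problem := {|
  instance := digraph * nat;
  encodes := fun Dk x =>
    exists2 y, encodes_digraph Dk.1 y & x = rcons y Dk.2;
  is_answer := fun Dk out => out <= 1 /\
    (out = 1 <->
     exists2 f, @dominating_broadcast Dk.1 f & cost f <= Dk.2) |}.

Definition minimum_broadcast_cost : problem := {|
  instance := digraph;
  encodes := encodes_digraph;
  is_answer := fun D b =>
    (exists2 f, @dominating_broadcast D f & cost f = b) /\
    (forall f, @dominating_broadcast D f -> b <= cost f) |}.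

(* Main.v *)
(* In a single-sourced layered DAG, level i is the set of vertices at distance i
   from the source.  Charge a broadcast f by pay(j) = #{v : lay v < j <= lay v +
   f v}.  A level with pay 0 must broadcast from each of its vertices, so it
   saves one unit only if it is a singleton other than the last level, and two
   consecutive levels cannot both be unpaid.  Hence the optimal cost is the
   number of levels minus the maximum number of pairwise nonconsecutive
   singleton levels other than the last.  The maximum is found by taking levels
   greedily; it is attained by letting the vertex of each taken level reach up
   to the level before the next taken one.  Level sizes are computed by
   breadth-first search. *)
From mathcomp Require Import all_boot zify.
Require Import Defs.

Set Implicit Arguments.
Unset Strict Implicit.
Unset Printing Implicit Defensive.

(** * Greedy choice of singleton levels *)

Section Greedy.

Variable sz : nat -> nat.

(** Levels beyond the last one are empty, so [0 < sz i.+1] excludes the last level without naming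
    it. *)
Fixpoint taken (i : nat) : bool :=
  [&& sz i == 1, 0 < sz i.+1 & if i is j.+1 then ~~ taken j else true].

Arguments taken : simpl never.

Definition taken_before (i : nat) : bool :=
  if i is j.+1 then taken j else false.

Lemma takenE i : taken i = [&& sz i == 1, 0 < sz i.+1 & ~~ taken_before i].
Proof. by case: i. Qed.

Definition untaken (m : nat) : nat := \sum_(0 <= i < m) ~~ taken i.

Lemma untakenS m : untaken m.+1 = untaken m + ~~ taken m.
Proof. exact: big_nat_recr. Qed.

(* The last taken level up to [j], or the junk value 0 if there is none. *)
Fixpoint owner (j : nat) : nat :=
  if taken j then j else if j is i.+1 then owner i else 0.

Lemma owner_le j : owner j <= j.
Proof. by elim: j => [|j IH] /=; case: ifP => // _; lia. Qed.

Lemma ownerP j : taken (owner j) \/ owner j = 0.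
Proof.
elim: j => [|j IH] /=; first by case: ifP => [|_]; [left | right].
by case: ifP => [|_] //; left.
Qed.

(** The downward search from [j] runs past [k] without stopping, so [k] is untaken and the search
    from [k] ends at [i] too. This also covers the default value 0. *)
Lemma owner_between i k j : owner j = i -> i < k <= j ->
  ~~ taken k && (owner k == i).
Proof.
elim: j => [|j IH] /=; first by lia.
case: ifP => [_ <- | tj oj]; first by lia.
case: (ltngtP k j.+1) => [kj|//|-> _]; first by move=> ?; apply: IH => //; lia.
  by lia.
by rewrite /= !tj oj eqxx.
Qed.

(* [pay j] is the number of units of the broadcast spent on reaching level j.
   An unpaid level has to broadcast from each of its vertices. *)
Lemma untaken_le_pay (pay : nat -> nat) (t : nat) :
  (forall i, (0 < sz i) = (i <= t)) -> pay 0 = 0 ->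
  (forall i, i <= t -> pay i = 0 -> sz i <= pay i.+1) ->
  untaken t.+1 <= \sum_(0 <= j < t.+2) pay j.
Proof.
move=> sz_gt0 pay0 payS.
(* An unpaid level with two vertices makes the next level be paid twice. *)
pose spare i := (pay i == 0) && ~~ ((sz i == 1) && (i < t)).
have szp i : i <= t -> 0 < sz i by rewrite sz_gt0.
(* The debt [spare i] is repaid by level [i.+1]. The credit [taken i && (pay i != 0)] records that
   the broadcast has paid a level that the greedy choice skips; it is spent if the broadcast skips
   level [i.+1], which is then not taken. *)
have inv i : i <= t ->
    untaken i.+1 + (taken i && (pay i != 0)) <=
    \sum_(0 <= j < i.+1) pay j + spare i.
  elim: i => [|i IH] lei.
    rewrite untakenS /untaken big_geq // big_nat1 takenE /spare pay0 eqxx /=.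
    by rewrite sz_gt0; lia.
  rewrite untakenS big_nat_recr //= [taken i.+1]takenE /= sz_gt0 /spare.
  have := IH (ltnW lei); rewrite /spare.
  have := payS i (ltnW lei); have := szp i (ltnW lei).
  set s := \sum_(_ <= _ < _) _; set u := untaken _.
  by case: (taken i); lia.
rewrite big_nat_recr //=.
have := inv t (leqnn t); have := payS t (leqnn t); have := szp t (leqnn t).
by rewrite /spare; set s := \sum_(_ <= _ < _) _; lia.
Qed.

End Greedy.

Arguments taken : simpl never.
Arguments owner : simpl never.

(** * Broadcasts on levels *)

Section Levels.

Variables (D : digraph) (t : nat) (lay : 'I_(order D) -> nat).
Notation vertex := 'I_(order D).

Definition level_size (i : nat) : nat := #|[pred v | lay v == i]|.

Hypothesis lay_arc : forall u v : vertex, arc u v -> lay v = (lay u).+1.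
Hypothesis lay_pred : forall v : vertex, 0 < lay v -> exists u, arc u v.
Hypothesis level_size0 : level_size 0 = 1.
Hypothesis level_size_gt0 : forall i, (0 < level_size i) = (i <= t).

Notation sz := level_size.

Lemma path_lay u p : path (@arc D) u p -> lay (last u p) = lay u + size p.
Proof.
elim: p u => [|v p IH] u /=; first by rewrite addn0.
by case/andP=> /lay_arc uv /IH ->; rewrite uv; lia.
Qed.

(** Arcs raise [lay] by one, so all paths between two given vertices have the same length and
    minimality is automatic. *)
Lemma is_distanceE u v d : is_distance u v d <->
  (exists p, [/\ path (@arc D) u p, last u p = v & size p = d]).
Proof.
split=> [[]//|[p [up pv sp]]]; split; first by exists p.
by move=> q uq qv; have := path_lay up; have := path_lay uq; rewrite pv qv; lia.
Qed.

Lemma lay_le v : lay v <= t.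
Proof. by rewrite -level_size_gt0; apply/card_gt0P; exists v; rewrite inE. Qed.

Lemma ancestor v i : i <= lay v ->
  exists u p, [/\ lay u = i, path (@arc D) u p, last u p = v &
                  size p = lay v - i].
Proof.
move=> le_i; have [d def_d] : exists d, d = lay v - i by exists (lay v - i).
rewrite -def_d.
elim: d v le_i def_d => [|d IH] v le_i def_d.
  by exists v, [::]; split=> //=; lia.
have [w wv] : exists w, arc w v by apply: lay_pred; lia.
have lw := lay_arc wv; have [||u [p [lu up pw sp]]] := IH w; try lia.
by exists u, (rcons p v); rewrite rcons_path last_rcons size_rcons up pw sp.
Qed.

Definition pay (f : {ffun vertex -> nat}) (j : nat) : nat :=
  \sum_v (lay v < j <= lay v + f v).

(** After exchanging the sums, a vertex [v] is counted only at the levels [lay v + 1] to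
    [lay v + f v], hence at most [f v] times. *)
Lemma sum_pay f m : \sum_(0 <= j < m) pay f j <= cost f.
Proof.
rewrite exchange_big /=; apply: leq_sum => v _.
elim: m => [|m IH]; first by rewrite big_geq.
have [le_m | lt_m] := leqP m (lay v + f v); last first.
  by rewrite big_nat_recr //=; lia.
suff: \sum_(0 <= j < m.+1) (lay v < j <= lay v + f v) <= m - lay v by lia.
elim: m {IH le_m} => [|m IH]; first by rewrite big_nat1; lia.
by rewrite big_nat_recr //=; lia.
Qed.

(** A vertex dominated through a nonempty path has a paid level. So each vertex of an unpaid level
    covers itself, with a positive value, and pays for the next level. *)
Lemma unpaid_level f i : dominating_broadcast f -> pay f i = 0 ->
  sz i <= pay f i.+1.
Proof.
move=> domf /eqP; rewrite sum_nat_eq0 => /forallP pay0.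
rewrite /level_size -sum1_card big_mkcond; apply: leq_sum => v _ /=.
rewrite inE; case: eqP => // lv.
have [u [fu [d /is_distanceE [p [up pv sp]] le_d]]] := domf v.
have := pay0 u; have := path_lay up; rewrite pv lv.
case: p up pv sp => [|w p] /=.
  by move=> _ uv _ _ _; rewrite uv in fu; lia.
by lia.
Qed.

Lemma untaken_le_cost (f : {ffun vertex -> nat}) :
  dominating_broadcast f -> untaken sz t.+1 <= cost f.
Proof.
move=> domf; apply: leq_trans (sum_pay f t.+2).
apply: untaken_le_pay => // [|i _]; last exact: unpaid_level.
by rewrite /pay big1 // => v _; rewrite ltn0.
Qed.

(** Every untaken level charges one unit to its owner. Level 0 is taken unless [t] is 0; then the
    default owner makes the source pay for itself. *)
Definition greedy_broadcast : {ffun vertex -> nat} :=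
  [ffun v => \sum_(0 <= j < t.+1) (~~ taken sz j && (owner sz j == lay v))].

Lemma size_owner_level j : sz (owner sz j) = 1.
Proof.
by case: (ownerP sz j) => [|->//]; rewrite takenE => /and3P[/eqP].
Qed.

Lemma cost_greedy_broadcast : cost greedy_broadcast = untaken sz t.+1.
Proof.
rewrite /cost; under eq_bigr do rewrite ffunE.
rewrite exchange_big; apply: eq_bigr => j _ /=.
case: (taken sz j) => /=; first by rewrite big1.
rewrite -(size_owner_level j) /level_size -sum1_card [RHS]big_mkcond /=.
by apply: eq_bigr => v _; rewrite inE eq_sym; case: eqP.
Qed.

(** The witness for [v] is its ancestor [u] on the owner level: all levels above [lay u] up to
    [lay v] are charged to [u], and their number is the distance. *)
Lemma greedy_broadcast_dominating : dominating_broadcast greedy_broadcast.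
Proof.
move=> v; have [u [p [lu up pv sp]]] := ancestor (owner_le sz (lay v)).
have lev := lay_le v; have leo := owner_le sz (lay v).
have count_between m : m <= lay v ->
    \sum_(0 <= j < m.+1) (~~ taken sz j && (owner sz j == lay u)) >= m - lay u.
  elim: m => [|m IH] lem //; rewrite big_nat_recr //=.
  have := IH (ltnW lem); set s := \sum_(_ <= _ < _) _.
  have [lt_um|] := ltnP (lay u) m.+1; last by lia.
  have -> : ~~ taken sz m.+1 && (owner sz m.+1 == lay u).
    by apply: (owner_between (j := lay v)); rewrite ?lu //; lia.
  by lia.
have le_d : size p <= greedy_broadcast u.
  rewrite sp ffunE (big_cat_nat (n := (lay v).+1)) //= -lu.
  by apply: leq_trans (leq_addr _ _); apply: count_between.
exists u; split; last by exists (size p); rewrite ?is_distanceE //; exists p.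
(* Only positivity is left; it is not immediate when [v] lies on its own owner level. If that level
   is taken, it owns the next level, which is untaken; otherwise it is charged for itself. *)
case: (ltnP (owner sz (lay v)) (lay v)) => [lt_o|ge_o]; first by lia.
have own_u : owner sz (lay u) = lay u by rewrite lu; congr owner; lia.
have [tu | ntu] := boolP (taken sz (lay u)).
  have := tu; rewrite takenE level_size_gt0 => /and3P[_ lt_ut _].
  have ntS : ~~ taken sz (lay u).+1 by rewrite takenE /= tu !andbF.
  have own_S : owner sz (lay u).+1 = lay u by rewrite /owner (negPf ntS).
  rewrite ffunE (big_cat_nat (n := (lay u).+1)) ?(big_ltn (m := (lay u).+1)) //=.
    by rewrite ntS own_S eqxx; lia.
  by lia.
rewrite ffunE (big_cat_nat (n := lay u)) ?(big_ltn (m := lay u)) //=; lia.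
Qed.

End Levels.

(** The level of a vertex is the index of its class. [V_ ord0] is nonempty and made of sources, so
    it is the singleton of the unique source; every other vertex has an in-neighbour. *)
Lemma single_sourced_levels (D : digraph) : single_sourced_layered_dag D ->
  exists t (lay : 'I_(order D) -> nat),
    [/\ forall u v, arc u v -> lay v = (lay u).+1,
        forall v, 0 < lay v -> exists u, arc u v,
        level_size lay 0 = 1 &
        forall i, (0 < level_size lay i) = (i <= t)].
Proof.
case=> _ [_ [t [V_ [injV partV srcV _ arcV]]]] /eqP/cards1P[s srcE].
have Vex v : exists i, v \in V_ i.
  case/and3P: partV => /eqP/setP/(_ v); rewrite inE => /bigcupP[A].
  by case/imsetP=> i _ -> ?; exists i.
have Vuniq v i j : v \in V_ i -> v \in V_ j -> i = j.
  case/and3P: partV => _ /trivIsetP trivV _ vi vj; apply: injV; apply/eqP.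
  apply: contraT => nij; have := trivV _ _ (imset_f V_ (erefl : i \in 'I_t.+1))
    (imset_f V_ (erefl : j \in 'I_t.+1)) nij.
  by rewrite -setI_eq0 => /eqP/setP/(_ v); rewrite !inE vi vj.
have Vne i : exists v, v \in V_ i.
  case/and3P: partV => _ _ /imsetP nV; apply/set0Pn/eqP => Vi0.
  by case: nV; exists i.
pose lay v := if [pick i | v \in V_ i] is Some i then val i else 0.
have layE v i : v \in V_ i -> lay v = i.
  move=> vi; rewrite /lay; case: pickP => [j vj|/(_ i)]; last by rewrite vi.
  by rewrite (Vuniq v i j).
have s0 : s \in V_ ord0.
  have [v v0] := Vne ord0; suff: v = s by move=> <-.
  by apply/set1P; rewrite -srcE inE srcV.
have src_s v : source v = (v == s) by rewrite -in_set1 -srcE inE.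
exists t, lay; split.
- move=> u v /arcV[i [j [ui vj ij]]].
  by rewrite (layE u i) // (layE v j).
- move=> v lv; have: ~~ source v.
    by rewrite src_s; apply: contraTneq lv => ->; rewrite (layE s ord0).
  by rewrite negb_forall => /existsP[u]; rewrite negbK => uv; exists u.
- rewrite /level_size; apply/eqP/fintype.card1P; exists s => v; rewrite !inE.
  apply/eqP/eqP => [lv|->]; last exact: (layE s ord0 s0).
  have [i vi] := Vex v; apply/eqP; rewrite -src_s; apply: srcV.
  by have/esym := layE _ _ vi; rewrite lv => /(@ord_inj _ i ord0) <-.
- move=> i; apply/card_gt0P/idP => [[v]|lei].
    rewrite inE => /eqP <-; have [j vj] := Vex v.
    by rewrite (layE _ _ vj) -ltnS.
  have [v vi] := Vne (Ordinal (lei : i < t.+1)).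
  by exists v; rewrite inE (layE _ _ vi).
Qed.

(** * Structured programs and their compilation *)

Inductive cmd :=
  | Skip
  | Op of instruction
  | Seq of cmd & cmd
  | IfLt of nat & nat & cmd & cmd
  | WhileLt of nat & nat & cmd.

Coercion Op : instruction >-> cmd.
Notation "c1 ;; c2" := (Seq c1 c2) (at level 85, right associativity).

Fixpoint code_size (c : cmd) : nat :=
  match c with
  | Skip => 0
  | Op _ => 1
  | Seq c1 c2 => code_size c1 + code_size c2
  | IfLt _ _ c1 c2 => (code_size c2 + code_size c1).+2
  | WhileLt _ _ c1 => (code_size c1).+3
  end.

(** Jump targets are absolute, so [l] is the address where the code is loaded. The else-branch comes
    first because [JumpLt] jumps when its test succeeds. *)
Fixpoint compile (l : nat) (c : cmd) : program :=
  match c with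
  | Skip => [::]
  | Op i => [:: i]
  | Seq c1 c2 => compile l c1 ++ compile (l + code_size c1) c2
  | IfLt i j c1 c2 =>
      let l1 := l + (code_size c2).+2 in
      JumpLt i j l1 :: compile l.+1 c2 ++ Jump (l1 + code_size c1)
        :: compile l1 c1
  | WhileLt i j c1 =>
      JumpLt i j l.+2 :: Jump (l + (code_size c1).+3)
        :: rcons (compile l.+2 c1) (Jump l)
  end.

Lemma size_compile l c : size (compile l c) = code_size c.
Proof.
elim: c l => //= [c1 IH1 c2 IH2|i j c1 IH1 c2 IH2|i j c1 IH1] l.
- by rewrite size_cat IH1 IH2.
- by rewrite size_cat /= IH1 IH2 addnS.
- by rewrite size_rcons IH1.
Qed.

(** * Timed semantics of structured programs and rules for verifying them *)

Section Execution.

Variable w : nat.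

Implicit Types (r m : nat -> nat).

(** The number counts the machine steps of the compiled code, its jumps included. [ExecOp] demands
    that the instruction fall through to the next address. *)
Inductive exec : cmd -> (nat -> nat) -> (nat -> nat) ->
    nat -> (nat -> nat) -> (nat -> nat) -> Prop :=
  | ExecSkip r m : exec Skip r m 0 r m
  | ExecOp i r m r' m' :
      (forall p l, nth Halt p l = i ->
        step w p (State l r m) = State l.+1 r' m') ->
      exec (Op i) r m 1 r' m'
  | ExecSeq c1 c2 t1 t2 r m r1 m1 r2 m2 :
      exec c1 r m t1 r1 m1 -> exec c2 r1 m1 t2 r2 m2 ->
      exec (Seq c1 c2) r m (t1 + t2) r2 m2
  | ExecIfTrue i j c1 c2 t r m r' m' :
      r i < r j -> exec c1 r m t r' m' -> exec (IfLt i j c1 c2) r m t.+1 r' m'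
  | ExecIfFalse i j c1 c2 t r m r' m' :
      r j <= r i -> exec c2 r m t r' m' ->
      exec (IfLt i j c1 c2) r m t.+2 r' m'
  | ExecWhileTrue i j c t1 t2 r m r1 m1 r2 m2 :
      r i < r j -> exec c r m t1 r1 m1 ->
      exec (WhileLt i j c) r1 m1 t2 r2 m2 ->
      exec (WhileLt i j c) r m (t1 + t2).+2 r2 m2
  | ExecWhileFalse i j c r m :
      r j <= r i -> exec (WhileLt i j c) r m 2 r m.

Lemma step_jump p l l' r m : nth Halt p l = Jump l' ->
  step w p (State l r m) = State l' r m.
Proof. by rewrite /step /fetch /= => ->. Qed.

Lemma step_jumplt p l i j l' r m : nth Halt p l = JumpLt i j l' ->
  step w p (State l r m) = State (if r i < r j then l' else l.+1) r m.
Proof. by rewrite /step /fetch /= => ->. Qed.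

Local Arguments step : simpl never.

Definition code_at (p : program) (l : nat) (q : program) : Prop :=
  forall k, k < size q -> nth Halt p (l + k) = nth Halt q k.

Lemma code_at_cat p l q1 q2 :
  code_at p l (q1 ++ q2) -> code_at p l q1 /\ code_at p (l + size q1) q2.
Proof.
move=> pq; split=> k lt_k.
  by rewrite pq ?nth_cat ?lt_k // size_cat ltn_addr.
by rewrite -addnA pq ?size_cat ?ltn_add2l // nth_cat ltnNge leq_addr /= addKn.
Qed.

Lemma code_at_cons p l a q :
  code_at p l (a :: q) -> nth Halt p l = a /\ code_at p l.+1 q.
Proof.
move=> pq; split=> [|k lt_k]; first by rewrite -(addn0 l) (pq 0).
by rewrite addSnnS (pq k.+1).
Qed.

Lemma exec_compile c r m t r' m' : exec c r m t r' m' ->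
  forall p l, code_at p l (compile l c) ->
  iter t (step w p) (State l r m) = State (l + code_size c) r' m'.
Proof.
elim=> {c r m t r' m'} /=.
- by move=> r m p l _; rewrite addn0.
- by move=> i r m r' m' st p l /code_at_cons[/st -> _]; rewrite addn1.
- move=> c1 c2 t1 t2 r m r1 m1 r2 m2 _ IH1 _ IH2 p l /code_at_cat[].
  rewrite size_compile => /IH1 E1 /IH2 E2.
  by rewrite addnC iterD E1 E2 addnA.
- move=> i j c1 c2 t r m r' m' lt_ij _ IH p l.
  case/code_at_cons=> E /code_at_cat[_ /code_at_cons[_]].
  rewrite size_compile => pc1.
  rewrite -?iterS iterSr (step_jumplt _ _ E) lt_ij IH.
    by congr State; lia.
  by move: pc1; congr code_at; lia.
- move=> i j c1 c2 t r m r' m' le_ji _ IH p l.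
  case/code_at_cons=> E /code_at_cat[/IH E1 /code_at_cons[]].
  rewrite size_compile => E2 _.
  rewrite -?iterS iterSr (step_jumplt _ _ E) ltnNge le_ji /= E1.
  by rewrite (step_jump _ _ E2); congr State; lia.
- move=> i j c t1 t2 r m r1 m1 r2 m2 lt_ij _ IH1 _ IH2 p l pl.
  have := pl; rewrite -cats1.
  case/code_at_cons=> E /code_at_cons[_ /code_at_cat[]].
  rewrite size_compile => /IH1 E1 /code_at_cons[E2 _].
  rewrite -?iterS iterSr (step_jumplt _ _ E) lt_ij (addnC t1) -addSn iterD.
  by rewrite E1 iterSr (step_jump _ _ E2) IH2.
- move=> i j c r m le_ji p l /code_at_cons[E /code_at_cons[E1 _]].
  by rewrite (step_jumplt _ _ E) ltnNge le_ji (step_jump _ _ E1).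
Qed.

(** [T] is the time already spent, so that [Q] can speak about the total running time. *)
Definition reaches (c : cmd) (Q : nat -> (nat -> nat) -> (nat -> nat) -> Prop)
    (T : nat) r m : Prop :=
  exists t r' m', exec c r m t r' m' /\ Q (T + t) r' m'.

(* Sufficient conditions for [reaches] under which no arithmetic operation
   wraps around. *)
Fixpoint vc (c : cmd) (Q : nat -> (nat -> nat) -> (nat -> nat) -> Prop)
    (T : nat) r m : Prop :=
  match c with
  | Skip => Q T r m
  | Op (Const i a) => a < 2 ^ w /\ Q T.+1 (update r i a) m
  | Op (Move i j) => r j < 2 ^ w /\ Q T.+1 (update r i (r j)) m
  | Op (Add i j k) =>
      r j + r k < 2 ^ w /\ Q T.+1 (update r i (r j + r k)) m
  | Op (Read i j) => m (r j) < 2 ^ w /\ Q T.+1 (update r i (m (r j))) m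
  | Op (Write i j) => Q T.+1 r (update m (r i) (r j))
  | Op _ => False
  | Seq c1 c2 => vc c1 (vc c2 Q) T r m
  | IfLt i j c1 c2 =>
      (r i < r j -> vc c1 Q T.+1 r m) /\
      (r j <= r i -> vc c2 Q T.+2 r m)
  | WhileLt i j c1 => reaches (WhileLt i j c1) Q T r m
  end.

Lemma vcP c Q T r m : vc c Q T r m -> reaches c Q T r m.
Proof.
elim: c Q T r m => [|i|c1 IH1 c2 IH2|i j c1 IH1 c2 IH2|i j c IH] Q T r m //=.
- by exists 0, r, m; rewrite addn0; split=> //; constructor.
- have op r' m' : (forall p l, nth Halt p l = i ->
      step w p (State l r m) = State l.+1 r' m') ->
      Q T.+1 r' m' -> reaches i Q T r m.
    by move=> st q; exists 1, r', m'; rewrite addn1; split=> //; constructor.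
  by case: i op => // [i a|i j|i j k|i j|i j] op;
    first [case=> lt q; apply: op q => p l E | move/op; apply=> p l E];
    rewrite /step /fetch /= E ?modn_small.
- case/IH1=> t1 [r1 [m1 [e1 /IH2[t2 [r2 [m2 [e2 q]]]]]]].
  exists (t1 + t2), r2, m2; rewrite addnA; split=> //.
  exact: ExecSeq e1 e2.
- case: (ltnP (r i) (r j)) => [lt_ij [/(_ isT)/IH1 + _]|le_ji [_ /(_ isT)/IH2]].
    case=> t [r' [m' [e q]]]; exists t.+1, r', m'; rewrite -addSnnS.
    by split=> //; constructor.
  case=> t [r' [m' [e q]]]; exists t.+2, r', m'; rewrite -2!addSnnS.
  by split=> //; constructor.
Qed.

Lemma reaches_weaken c (Q Q' : nat -> (nat -> nat) -> (nat -> nat) -> Prop)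
    T r m :
  (forall T r m, Q T r m -> Q' T r m) ->
  reaches c Q T r m -> reaches c Q' T r m.
Proof.
by move=> QQ' [t [r' [m' [e q]]]]; exists t, r', m'; split=> //; apply: QQ'.
Qed.

(** The two steps added to [T] before the body are the test and the jump back, charged in advance;
    at the end they are the failed test and the jump out. *)
Lemma while_rule (I : nat -> nat -> (nat -> nat) -> (nat -> nat) -> Prop)
    (N : nat) i j c Q T r m :
  I 0 T r m ->
  (forall k T r m, k < N -> I k T r m ->
    r i < r j /\ vc c (I k.+1) T.+2 r m) ->
  (forall T r m, I N T r m -> r j <= r i /\ Q T.+2 r m) ->
  reaches (WhileLt i j c) Q T r m.
Proof.
move=> I0 IS IN.
suff loop d k T1 r1 m1 : k + d = N -> I k T1 r1 m1 ->
    reaches (WhileLt i j c) Q T1 r1 m1 by apply: loop I0; exact: add0n.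
elim: d k T1 r1 m1 => [|d IH] k T1 r1 m1.
  rewrite addn0 => -> /IN[le_ji q]; exists 2, r1, m1; rewrite addn2; split=> //.
  exact: ExecWhileFalse.
move=> def_k Ik; have [|lt_ij /vcP] := IS k _ _ _ _ Ik; first by lia.
case=> t1 [r2 [m2 [e1 /IH[|t2 [r3 [m3 [e2 q]]]]]]]; first by lia.
exists (t1 + t2).+2, r3, m3; split; first exact: ExecWhileTrue e1 e2.
by rewrite -2!addSnnS addnA.
Qed.

Lemma reaches_outputs c (x : seq nat) B out :
  reaches c (fun T r _ => T <= B /\ r 0 = out) 0 (fun=> 0) (nth 0 x) ->
  outputs w (compile 0 c) x B out.
Proof.
case=> t [r [m [e [le_t <-]]]]; exists t => //=.
rewrite (exec_compile e (l := 0)) //= /halted /fetch /=.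
(* Beyond the end of the code, [fetch] returns the default [Halt]. *)
by rewrite nth_default // size_compile.
Qed.

End Execution.

Arguments update f i a j /.

Lemma reaches_seq w c1 c2 (P Q : nat -> (nat -> nat) -> (nat -> nat) -> Prop)
    T r m :
  reaches w c1 P T r m -> (forall T r m, P T r m -> reaches w c2 Q T r m) ->
  reaches w (c1;; c2) Q T r m.
Proof.
case=> t1 [r1 [m1 [e1 /[swap] h /h[t2 [r2 [m2 [e2 q]]]]]]].
by exists (t1 + t2), r2, m2; rewrite addnA; split=> //; apply: ExecSeq e1 e2.
Qed.

Lemma vc_seq w c1 c2 Q T r m :
  vc w c1 (vc w c2 Q) T r m -> vc w (c1;; c2) Q T r m.
Proof. by []. Qed.

(** * The linear-time algorithm *)

(* Registers: 0 cost so far, 1 number n of vertices, 2 end E of the encoding,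
   3, 4 and 5 the bases E + 1, E + 1 + n and E + 1 + 2n of the arrays below,
   6 the constant 1, 7 the constant 0, 15 whether the previous level is taken.
   Arrays, each of n cells: the addresses of the adjacency lists, then marks (1
   for a vertex that is not yet discovered), then the queue of the search. *)
Definition locate_arrays : cmd :=
  Const 6 1;; Read 1 7;; Move 8 6;; Const 9 0;;
  WhileLt 9 1 (Read 10 8;; Add 8 8 10;; Add 8 8 6;; Add 9 9 6);;
  Move 2 8;; Add 3 8 6;; Add 4 3 1;; Add 5 4 1.

(* Only the source has no incoming arc, hence stays unmarked. *)
Definition mark_heads : cmd :=
  Move 8 6;; Const 9 0;;
  WhileLt 9 1 (
    Add 11 3 9;; Write 11 8;; Read 10 8;; Add 8 8 6;; Add 10 8 10;;
    WhileLt 8 10 (Read 12 8;; Add 11 4 12;; Write 11 6;; Add 8 8 6);;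
    Add 9 9 6).

(** The loop needs no test against the number of vertices, since the source is unmarked. The source
    then forms the first level in the queue. *)
Definition find_source : cmd :=
  Const 9 0;; Read 12 4;;
  WhileLt 7 12 (Add 9 9 6;; Add 11 4 9;; Read 12 11);;
  Write 5 9;; Move 9 5;; Add 13 9 6.

(* Registers 9, 13 and 14: the next vertex to scan, the end of the current level
   and the end of the queue. *)
Definition scan_vertex : cmd :=
  WhileLt 8 10 (
    Read 12 8;; Add 11 4 12;; Read 17 11;;
    IfLt 7 17 (Write 11 7;; Write 14 12;; Add 14 14 6) Skip;;
    Add 8 8 6).

Definition scan_level : cmd :=
  WhileLt 9 13 (
    Read 12 9;; Add 11 3 12;; Read 8 11;; Read 10 8;; Add 8 8 6;;
    Add 10 8 10;; scan_vertex;; Add 9 9 6).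

(** Register 16 holds the start of the level plus one. Being below register 13 thus reveals a second
    vertex, while 13 below 14 reveals a nonempty next level. *)
Definition detect_taken : cmd :=
  Const 18 0;;
  IfLt 16 13 Skip (IfLt 13 14 (IfLt 15 6 (Const 18 1) Skip) Skip).

Definition scan_levels : cmd :=
  WhileLt 9 13 (
    Add 16 9 6;; Move 14 13;; scan_level;; detect_taken;;
    Move 15 18;; IfLt 18 6 (Add 0 0 6) Skip;; Move 13 14).

Definition broadcast_cost : cmd :=
  locate_arrays;; mark_heads;; find_source;; scan_levels.

(** The bound is stored right after the digraph, at the address kept in register 2. *)
Definition broadcast_decision : cmd :=
  broadcast_cost;; Read 12 2;; IfLt 12 0 (Const 0 0) (Const 0 1).

(** * Correctness and running time of the search *)

Section Search.

Variables (w n s t key : nat) (ad : nat -> seq nat) (lay : nat -> nat).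

(** The address of the degree of [u]; the outer successor accounts for the leading cell, which holds
    the number of vertices. Thus [off n] is the length of the encoding. *)
Definition off (u : nat) : nat := (\sum_(0 <= v < u) (size (ad v)).+1).+1.

Lemma offS u : off u.+1 = off u + (size (ad u)).+1.
Proof. by rewrite /off big_nat_recr. Qed.

Lemma off_gt u : u < off u.
Proof. by elim: u => // u; rewrite offS; lia. Qed.

Lemma off_le u v : u <= v -> off u <= off v.
Proof.
elim: v => [|v IH]; first by rewrite leqn0 => /eqP->.
by rewrite leq_eqVlt ltnS => /orP[/eqP->//|/IH]; rewrite offS; lia.
Qed.

Lemma off_end u : u < n -> off u + size (ad u) < off n.
Proof. by move/off_le; rewrite offS; lia. Qed.

Definition level_count (i : nat) : nat :=
  count (fun v => lay v == i) (iota 0 n).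

Hypothesis ad_lay : forall u v, u < n -> v \in ad u ->
  v < n /\ lay v = (lay u).+1.
Hypothesis lay_ad : forall v, v < n -> 0 < lay v ->
  exists2 u, u < n & v \in ad u.
Hypothesis s_lt_n : s < n.
Hypothesis lay_eq0 : forall v, v < n -> (lay v == 0) = (v == s).
Hypothesis level_count_gt0 : forall i, (0 < level_count i) = (i <= t).
(** The arrays end at [off n + 1 + 3 * n], and [n < off n], so every address fits in a word. *)
Hypothesis word_size : 4 * off n + 4 < 2 ^ w.
Hypothesis key_lt : key < 2 ^ w.

Notation E := (off n).

Definition input (m : nat -> nat) : Prop :=
  [/\ m 0 = n, m E = key,
      forall u, u < n -> m (off u) = size (ad u) &
      forall u k, u < n -> k < size (ad u) ->
        m (off u + k.+1) = nth 0 (ad u) k].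

Definition offsets (m : nat -> nat) (k : nat) : Prop :=
  forall u, u < k -> m (E.+1 + u) = off u.

Definition marks (m : nat -> nat) (p : pred nat) : Prop :=
  forall v, v < n -> m (E.+1 + n + v) = p v.

Definition consts (r : nat -> nat) : Prop :=
  [/\ r 1 = n, r 2 = E, r 3 = E.+1, r 4 = E.+1 + n & r 5 = E.+1 + n + n] /\
  [/\ r 6 = 1 & r 7 = 0].

Lemma input_update m a x : E < a -> input m -> input (update m a x).
Proof.
move=> lt_a [m0 mE md mn]; have := off_gt n.
split=> /= [||u lt_u|u k lt_u lt_k]; case: eqP => // e.
- by lia.
- by lia.
- by have := off_end lt_u; lia.
- exact: md.
- by have := off_end lt_u; lia.
- exact: mn.
Qed.

Lemma offsets_update m a x k : E.+1 + k <= a -> offsets m k ->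
  offsets (update m a x) k.
Proof.
by move=> le_a mo u lt_u /=; case: eqP => [|_]; [lia | exact: mo].
Qed.

Lemma eq_marks m p q : marks m p -> {in gtn n, p =1 q} -> marks m q.
Proof. by move=> mp pq v lt_v; rewrite mp // pq. Qed.

Lemma marks_update m a x p : a < E.+1 + n \/ E.+1 + n + n <= a ->
  marks m p -> marks (update m a x) p.
Proof.
by move=> le_a mp v lt_v /=; case: eqP => [|_]; [lia | exact: mp].
Qed.

Lemma marks_set m a (b : bool) p :
  marks m p ->
  marks (update m (E.+1 + n + a) b) (fun v => if v == a then b else p v).
Proof.
move=> mp v lt_v /=; rewrite eqn_add2l; case: eqP => // _; exact: mp.
Qed.

Lemma locate_arraysP m : input m ->
  reaches w locate_arrays
    (fun T r m' => [/\ T <= 6 * n + 10, consts r, r 0 = 0, r 15 = 0 & m' = m])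
    0 (fun=> 0) m.
Proof.
move=> inm; have [m0 _ md _] := inm; have n_lt := off_gt n.
apply: vcP => /=; rewrite m0.
do 4! (split; first by lia).
apply: (while_rule (N := n) (I := fun k T r m' =>
  [/\ T <= 6 * k + 4, r 8 = off k, r 9 = k, m' = m &
      [/\ r 0 = 0, r 15 = 0, r 1 = n, r 6 = 1 & r 7 = 0]])).
- by split=> //; rewrite /off big_geq.
- move=> k T r _ lt_k [le_T r8 r9 -> [r0 r15 r1 r6 r7]].
  split; first by lia.
  rewrite /= r8 r9 r6 md //; have := off_end lt_k; rewrite /= => lt_E.
  do 4! (split; first by lia).
  by split=> //; rewrite ?offS; lia.
- move=> T r _ [le_T r8 r9 -> [r0 r15 r1 r6 r7]].
  split; first by lia.
  rewrite /= r8 r6 r1.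
  do 4! (split; first by lia).
  by split=> //; [lia | split; split=> //=; lia].
Qed.

Lemma mark_headsP T0 r m : consts r -> r 0 = 0 -> r 15 = 0 -> input m ->
  (forall a, E < a -> m a = 0) ->
  reaches w mark_heads
    (fun T r m =>
      [/\ T <= T0 + 10 * E, consts r, r 0 = 0, r 15 = 0 & input m] /\
      (offsets m n /\ marks m (fun v => 0 < lay v)))
    T0 r m.
Proof.
move=> cr r0 r15 inm m0; have [[r1 r2 r3 r4 r5] [r6 r7]] := cr.
have n_lt := off_gt n.
apply: vcP => /=; rewrite r6.
do 2! (split; first by lia).
pose head k v := has (fun u => v \in ad u) (iota 0 k).
have headS k v : head k.+1 v = head k v || (v \in ad k).
  by rewrite /head -addn1 iotaD has_cat /= orbF.
(* Time is measured by the address [off k] reached, at 10 steps per cell. The 8 is the slack at the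
   start, where [off 0] is 1 and two steps are spent. *)
apply: (while_rule (N := n) (I := fun k T r m =>
  [/\ T + 8 <= T0 + 10 * off k, consts r, r 0 = 0, r 15 = 0 & input m] /\
  [/\ r 8 = off k, r 9 = k, offsets m k & marks m (head k)])).
- have -> : off 0 = 1 by rewrite /off big_geq.
  split; split=> //; first by lia.
  by move=> v lt_v; rewrite m0 //; lia.
- move=> k {}T {cr r0 r15 inm m0 r1 r2 r3 r4 r5 r6 r7}r {}m lt_k.
  case=> -[le_T cr r0 r15 inm] [r8 r9 om hm].
  have [[r1 r2 r3 r4 r5] [r6 r7]] := cr.
  split; first by lia.
  rewrite /= r3 r9 r8 r6; have := off_end lt_k.
  set m1 := update m _ _ => lt_E.
  have in1 : input m1 by apply: input_update => //; lia.
  have om1 : offsets m1 k.+1.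
    move=> u lt_u; rewrite /m1 /=.
    case: eqP => [?|ne_u]; first by congr off; lia.
    by apply: om; lia.
  have hm1 : marks m1 (head k) by apply: marks_update hm; lia.
  have -> : (if off k == E.+1 + k then off k else m (off k)) = size (ad k).
    by case: in1 => _ _ /(_ _ lt_k).
  do 4! (split; first by lia).
  apply: (while_rule (N := size (ad k)) (I := fun j T' r m =>
    [/\ T' <= T + 7 + 6 * j, consts r, r 0 = 0, r 15 = 0 & input m] /\
    [/\ r 8 = off k + 1 + j, r 9 = k, r 10 = off k + 1 + size (ad k),
        offsets m k.+1 &
        marks m (fun v => head k v || (v \in take j (ad k)))])).
  + split; split=> //=; try lia.
    by apply: eq_marks hm1 _ => v _; rewrite take0 orbF.
  + move=> j T1 {cr r0 r15 inm r1 r2 r3 r4 r5 r6 r7 r8 r9 om hm}r.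
    move=> {m1 in1 om1 hm1}m lt_j.
    case=> -[le_T1 cr r0 r15 inm] [r8 r9 r10 om hm].
    have [[r1 r2 r3 r4 r5] [r6 r7]] := cr; split; first by lia.
    have mj : m (r 8) = nth 0 (ad k) j.
      by case: inm => _ _ _ <- //; rewrite r8 -addnA add1n.
    have lt_v : nth 0 (ad k) j < n by case: (ad_lay lt_k (mem_nth 0 lt_j)).
    rewrite /= mj r4 r6.
    do 3! (split; first by lia).
    split; split=> //=; try lia.
    * by apply: input_update => //; lia.
    * by apply: offsets_update => //; lia.
    * apply: eq_marks (@marks_set _ (nth 0 (ad k) j) true _ hm) _ => v _ /=.
      rewrite (take_nth 0 lt_j) mem_rcons inE.
      by case: eqP => //=; rewrite orbT.
  + move=> T1 {cr r0 r15 inm r1 r2 r3 r4 r5 r6 r7 r8 r9 om hm}r.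
    move=> {m1 in1 om1 hm1}m.
    case=> -[le_T1 cr r0 r15 inm] [r8 r9 r10 om hm].
    have [[r1 r2 r3 r4 r5] [r6 r7]] := cr; split; first by lia.
    rewrite /= r9 r6; split; first by lia.
    split; split=> //=; rewrite ?offS; try lia.
    by apply: eq_marks hm _ => v _; rewrite take_size headS.
- move=> T {cr r0 r15 inm m0 r1 r2 r3 r4 r5 r6 r7}r {}m.
  case=> -[le_T cr r0 r15 inm] [r8 r9 om hm].
  have [[r1 r2 r3 r4 r5] [r6 r7]] := cr.
  split; first by lia.
  split; split=> //; first by lia.
  apply: eq_marks hm _ => v; rewrite inE => lt_v; apply/hasP/idP.
    by case=> u; rewrite mem_iota => /ad_lay/[apply]-[_ ->].
  by case/(lay_ad lt_v) => u lt_u uv; exists u; rewrite ?mem_iota.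
Qed.

Lemma find_sourceP T0 r m : consts r -> r 0 = 0 -> r 15 = 0 -> input m ->
  offsets m n -> marks m (fun v => 0 < lay v) ->
  reaches w find_source
    (fun T r m =>
      [/\ T <= T0 + 5 * n + 7, consts r, r 0 = 0, r 15 = 0 & input m] /\
      [/\ offsets m n, marks m (fun v => 0 < lay v), r 9 = E.+1 + n + n,
          r 13 = E.+1 + n + n + 1 & m (E.+1 + n + n) = s])
    T0 r m.
Proof.
move=> cr r0 r15 inm om lm; have [[r1 r2 r3 r4 r5] [r6 r7]] := cr.
have n_lt := off_gt n.
have lm_bool v : v < n -> m (E.+1 + n + v) <= 1 by move/lm->; lia.
have m_lt v : v < n -> m (E.+1 + n + v) < 2 ^ w by move/lm_bool; lia.
apply: vcP => /=; rewrite r4.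
split; first by lia.
split; first by rewrite -[_ + n]addn0 m_lt //; lia.
(* Every vertex before [s] is above level 0, hence marked: the loop runs exactly [s] times. *)
apply: (while_rule (N := s) (I := fun k T r m' =>
  [/\ T <= T0 + 5 * k + 2, consts r, r 0 = 0, r 15 = 0 & m' = m] /\
  [/\ r 9 = k & r 12 = m (E.+1 + n + k)])).
- by split; split=> //=; [lia | rewrite addn0].
- move=> k T {cr r0 r15 r1 r2 r3 r4 r5 r6 r7}r _ lt_k
    [[le_T cr r0 r15 ->] [r9 r12]].
  have [[r1 r2 r3 r4 r5] [r6 r7]] := cr.
  have lt_kn : k < n by lia.
  split; first by rewrite r7 r12 lm //; have := lay_eq0 lt_kn; lia.
  rewrite /= r4 r9 r6.
  do 2! (split; first by lia).
  rewrite addn1; split; first by apply: m_lt; lia.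
  by split; split=> //=; lia.
- move=> T {cr r0 r15 r1 r2 r3 r4 r5 r6 r7}r _
    [[le_T cr r0 r15 ->] [r9 r12]].
  have [[r1 r2 r3 r4 r5] [r6 r7]] := cr.
  split; first by rewrite r7 r12 lm //; have := lay_eq0 s_lt_n; lia.
  rewrite /= r5 r6 r9.
  do 2! (split; first by lia).
  split; split=> //=; try lia.
  + by apply: input_update => //; lia.
  + by apply: offsets_update => //; lia.
  + by apply: marks_update => //; lia.
  + by rewrite eqxx.
Qed.
Implicit Types l : seq nat.

(** This is the offset at which level [i] starts in the queue. *)
Definition below (i : nat) : nat := count (fun v => lay v < i) (iota 0 n).

Lemma belowS i : below i.+1 = below i + level_count i.
Proof.
by rewrite /below /level_count; elim: (iota 0 n) => //= v l; lia.
Qed.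

Lemma below_le i : below i <= n.
Proof. by rewrite -[leqRHS](size_iota 0); apply: count_size. Qed.

Definition level (i : nat) : pred nat := fun v => (v < n) && (lay v == i).

Lemma size_sub_level i l : uniq l -> {subset l <= level i} ->
  size l <= level_count i.
Proof.
move=> uniq_l sub_l; rewrite /level_count -size_filter.
apply: uniq_leq_size => // v /sub_l; rewrite unfold_in => /andP[lt_v lv].
by rewrite mem_filter lv mem_iota.
Qed.

Lemma perm_level i l : uniq l -> l =i level i ->
  perm_eq l [seq v <- iota 0 n | lay v == i].
Proof.
move=> uniq_l eq_l; apply: uniq_perm => [//||v].
  by rewrite filter_uniq ?iota_uniq.
by rewrite eq_l mem_filter mem_iota andbC.
Qed.

Lemma size_level i l : uniq l -> l =i level i -> size l = level_count i.
Proof.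
by move=> ul el; rewrite (perm_size (perm_level ul el)) size_filter.
Qed.

(* The queue holds the current level [l] followed by the vertices of the next
   level found so far. *)
Definition scanning (i : nat) (l : seq nat) (found : pred nat)
    (r m : nat -> nat) : Prop :=
  exists l' : seq nat,
    [/\ uniq l', l' =i found,
        r 14 = E.+1 + n + n + below i + size l + size l',
        forall k, k < size l + size l' ->
          m (E.+1 + n + n + below i + k) = nth 0 (l ++ l') k &
        marks m (fun v => (i < lay v) && ~~ found v)].

Lemma eq_scanning i l p q r m : p =1 q ->
  scanning i l p r m -> scanning i l q r m.
Proof.
move=> pq [l' [ul' el' r14 cells mk]]; exists l'; split=> // [v|].
  by rewrite el'; apply: pq.
by apply: eq_marks mk _ => v _; rewrite pq.
Qed.

Lemma scan_vertexP i u l found T0 r m :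
  u < n -> lay u = i -> size l = level_count i ->
  {subset found <= level i.+1} ->
  consts r -> input m -> offsets m n -> scanning i l found r m ->
  r 8 = off u + 1 -> r 10 = off u + 1 + size (ad u) ->
  reaches w scan_vertex (fun T r' m' =>
      [/\ T <= T0 + 10 * size (ad u) + 2, consts r', input m', offsets m' n &
          scanning i l (fun v => found v || (v \in ad u)) r' m'] /\
      [/\ r' 0 = r 0, r' 9 = r 9, r' 13 = r 13, r' 15 = r 15 & r' 16 = r 16])
    T0 r m.
Proof.
move=> lt_u lu size_l sub_found cr inm om sc r8 r10; have n_lt := off_gt n.
have lt_E := off_end lt_u.
(* Levels up to [i.+1] have at most [n] vertices in all, so the queue does not overrun its array. *)
have lt_b := below_le i.+2; rewrite !belowS -size_l in lt_b.
pose seen j v := found v || (v \in take j (ad u)).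
apply: (while_rule (N := size (ad u)) (I := fun j T r' m =>
  [/\ T <= T0 + 10 * j, consts r', input m, offsets m n &
      scanning i l (seen j) r' m] /\
  [/\ r' 0 = r 0, r' 9 = r 9, r' 13 = r 13, r' 15 = r 15 & r' 16 = r 16] /\
  [/\ r' 8 = off u + 1 + j & r' 10 = off u + 1 + size (ad u)])).
- split; [split=> //; first by lia | by split; rewrite ?addn0].
  by apply: eq_scanning sc => v; rewrite /seen take0 orbF.
- move=> j T {cr inm om sc r8 r10}r' {}m lt_j.
  case=> -[le_T cr inm om sc] [fr [r8 r10]].
  have [[_ _ r3 r4 _] [r6 r7]] := cr; have [l' [ul' el' r14 cells mk]] := sc.
  split; first by lia.
  set v := nth 0 (ad u) j.
  have mj : m (r' 8) = v.
    by case: inm => _ _ _ mn; rewrite r8 -addnA add1n mn.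
  have [lt_v lv] : v < n /\ lay v = i.+1.
    by rewrite -lu; apply: ad_lay => //; apply: mem_nth.
  have mv : m (E.+1 + n + v) = ~~ seen j v by rewrite mk // lv ltnSn.
  have sub_l' : {subset l' <= level i.+1}.
    move=> x; rewrite el' => /orP[/sub_found //|].
    move/mem_take/(ad_lay lt_u) => [lt_x lx].
    by rewrite unfold_in /level lt_x lx lu eqxx.
  have seenS x : seen j.+1 x = (x == v) || seen j x.
    by rewrite /seen (take_nth 0 lt_j) mem_rcons inE orbCA.
  rewrite /= mj r4 mv r6 r7.
  do 2! (split; first by lia).
  split; first by case: (seen j v); lia.
  split=> [new | old].
    have nv : v \notin l' by rewrite el'; move: new; rewrite lt0b.
    (* Adding [v] keeps the list duplicate-free within level [i.+1], so a queue cell is left for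
       [v]. *)
    have size_l' : (size l').+1 <= level_count i.+1.
      apply: (@size_sub_level _ (v :: l')); first by rewrite /= nv.
      move=> x; rewrite inE => /predU1P[->|/sub_l' //].
      by rewrite unfold_in /level lt_v lv eqxx.
    do 2! (split; first by lia).
    split=> //; split=> //=; try lia.
    + by apply: input_update; [lia | apply: input_update => //; lia].
    + by apply: offsets_update; [lia | apply: offsets_update => //; lia].
    + exists (rcons l' v); split=> //=.
      * by rewrite rcons_uniq nv.
      * by move=> x; rewrite mem_rcons inE el' -seenS.
      * by rewrite r14 size_rcons addn1 addnS.
      * move=> k; rewrite size_rcons -rcons_cat nth_rcons size_cat r14 => lt_k.
        have [-> | ne_k] := eqVneq k (size l + size l').
          by rewrite addnA eqxx ltnn.
        have lt_k' : k < size l + size l' by lia.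
        by rewrite lt_k' !ifF ?cells //; lia.
      * apply: marks_update; first by rewrite r14; lia.
        apply: eq_marks (@marks_set _ v false _ mk) _ => x _ /=.
        by rewrite seenS; case: eqP => //=; rewrite andbF.
  split; first by lia.
  split; first split=> //; first by lia.
    apply: eq_scanning sc => x; rewrite seenS.
    by case: eqP => // ->; move: old; rewrite leqn0 eqb0 negbK.
  by split=> //; split=> //=; lia.
- move=> T {cr inm om sc r8 r10}r' {}m.
  case=> -[le_T cr inm om sc] [fr [r8 r10]]; split; first by lia.
  split=> //; split=> //; first by lia.
  by apply: eq_scanning sc => v; rewrite /seen take_size.
Qed.

(** Arcs out of level [i] end on level [i.+1]; conversely, each vertex there has an in-neighbour,
    necessarily on level [i], and so is found. *)
Lemma scan_levelP i l T0 r m :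
  uniq l -> l =i level i ->
  consts r -> input m -> offsets m n -> scanning i l pred0 r m ->
  r 9 = E.+1 + n + n + below i -> r 13 = E.+1 + n + n + below i + size l ->
  reaches w scan_level (fun T r' m' =>
      [/\ T <= T0 + 11 * (\sum_(u <- l) (size (ad u)).+1) + 2, consts r',
          input m', offsets m' n & scanning i l (level i.+1) r' m'] /\
      [/\ r' 0 = r 0, r' 9 = r 13, r' 13 = r 13, r' 15 = r 15 & r' 16 = r 16])
    T0 r m.
Proof.
move=> uniq_l eq_l cr inm om sc r9 r13; have n_lt := off_gt n.
have size_l := size_level uniq_l eq_l.
have lt_b := below_le i.+2; rewrite !belowS -size_l in lt_b.
pose seen k v := has (fun u => v \in ad u) (take k l).
have seen_level k : {subset seen k <= level i.+1}.
  move=> v /hasP[u /mem_take]; rewrite eq_l => /andP[lt_u /eqP lu].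
  by move/(ad_lay lt_u) => [lt_v lv]; rewrite unfold_in /level lt_v lv lu eqxx.
(* A vertex costs at most 10 steps per out-neighbour and 11 for the rest. *)
apply: (while_rule (N := size l) (I := fun k T r' m =>
  [/\ T <= T0 + 11 * (\sum_(u <- take k l) (size (ad u)).+1), consts r',
      input m, offsets m n & scanning i l (seen k) r' m] /\
  [/\ r' 0 = r 0, r' 9 = r 9 + k, r' 13 = r 13, r' 15 = r 15 &
      r' 16 = r 16])).
- split; [split=> // | by rewrite addn0].
    by rewrite take0 big_nil; lia.
  by apply: eq_scanning sc => v; rewrite /seen take0.
- move=> k T {cr inm om sc}r' {}m lt_k.
  case=> -[le_T cr inm om sc] [q0 q9 q13 q15 q16].
  have [[_ _ r3 r4 _] [r6 r7]] := cr; have [l' [_ _ _ cells _]] := sc.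
  split; first by lia.
  have := mem_nth 0 lt_k; rewrite eq_l; set u := nth 0 l k.
  case/andP=> lt_u /eqP lu.
  have lt_E := off_end lt_u.
  have mk : m (r' 9) = u.
    by rewrite q9 r9 cells ?nth_cat ?lt_k // ltn_addr.
  have md : m (off u) = size (ad u) by case: inm => _ _ ->.
  rewrite /= mk r3 om // md r6.
  do 6! (split; first by lia).
  set r1 := update _ 10 _; set T1 := T.+2.+4.+2.
  have cr1 : consts r1 by [].
  apply: reaches_weaken (scan_vertexP T1 lt_u lu size_l (@seen_level k) cr1 inm
    om sc (erefl _) (erefl _)) => {mk md sc cells l' inm om}T' r'' m'.
  rewrite /r1 /= => -[[le_T' cr' inm' om' sc'] [f0 f9 f13 f15 f16]].
  have [_ [r6' _]] := cr'.
  rewrite /= r6' f9 q9; split; first by lia.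
  split; [split=> // | by split; rewrite //= ?f0 ?f13 ?f15 ?f16 //; lia].
    rewrite (take_nth 0 lt_k) -cats1 big_cat big_seq1 /= mulnDr.
    move: le_T; rewrite /T1 in le_T'; rewrite -/u.
    by set c := \sum_(_ <- _) _; lia.
  apply: eq_scanning sc' => v.
  by rewrite /seen (take_nth 0 lt_k) has_rcons orbC.
- move=> T {cr inm om sc}r' {}m.
  case=> -[le_T cr inm om sc] [q0 q9 q13 q15 q16].
  split; first by lia.
  split; [split=> // | by split=> //; lia].
    by rewrite take_size in le_T; lia.
  apply: eq_scanning sc => v; rewrite /seen take_size; apply/hasP/idP.
    by case=> u ul uv; apply: (seen_level (size l)); apply/hasP; exists u;
      rewrite ?take_size.
  case/andP=> lt_v /eqP lv.
  have [|u lt_u uv] := lay_ad lt_v; first by rewrite lv.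
  exists u => //; rewrite eq_l unfold_in /level lt_u /=.
  by have [_] := ad_lay lt_u uv; rewrite lv => -[->].
Qed.

Lemma detect_takenP (b : bool) Q T r m :
  r 6 = 1 -> b = [&& r 13 <= r 16, r 13 < r 14 & r 15 == 0] ->
  (forall T' r', T' <= T + 6 -> (forall j, j != 18 -> r' j = r j) ->
    r' 18 = b -> Q T' r' m) ->
  vc w detect_taken Q T r m.
Proof.
move=> r6 def_b qP; have := off_gt n => n_lt.
have upd x : forall j, j != 18 -> update r 18 x j = r j.
  by move=> j /=; case: eqP.
have upd2 x y : forall j, j != 18 -> update (update r 18 x) 18 y j = r j.
  by move=> j /=; case: eqP.
rewrite /detect_taken; split; first by lia.
rewrite /= r6; split=> [lt1 | le1].
  by apply: qP (upd _) _; rewrite /=; lia.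
split=> [lt2 | le2]; last by apply: qP (upd _) _; rewrite /=; lia.
split=> [lt3 | le3]; last by apply: qP (upd _) _; rewrite /=; lia.
by split; [lia | apply: qP (upd2 _ _) _; rewrite /=; lia].
Qed.

Lemma scan_levelsP T0 r m :
  consts r -> r 0 = 0 -> r 15 = 0 -> input m -> offsets m n ->
  marks m (fun v => 0 < lay v) -> r 9 = E.+1 + n + n ->
  r 13 = E.+1 + n + n + 1 -> m (E.+1 + n + n) = s ->
  reaches w scan_levels (fun T r m =>
      [/\ T <= T0 + 29 * E, consts r, input m &
          r 0 = untaken level_count t.+1])
    T0 r m.
Proof.
move=> cr r0 r15 inm om mk r9 r13 ms; have n_lt := off_gt n.
(* Levels are disjoint, so the list cells scanned so far number less than [E]; this makes the whole
   search linear. *)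
pose cost_below i := \sum_(v <- iota 0 n | lay v < i) (size (ad v)).+1.
have cost_belowS i : cost_below i.+1 =
    cost_below i + \sum_(v <- iota 0 n | lay v == i) (size (ad v)).+1.
  rewrite /cost_below (bigID (fun v => lay v < i)) /=; congr (_ + _);
    by apply: eq_bigl => v; lia.
have cost_below_lt i : cost_below i < E.
  rewrite /off ltnS /index_iota subn0 /cost_below.
  rewrite [leqRHS](bigID (fun v => lay v < i)).
  exact: leq_addr.
apply: (while_rule (N := t.+1) (I := fun i T r m =>
  [/\ T <= T0 + 28 * cost_below i, consts r, input m, offsets m n &
      marks m (fun v => i < lay v)] /\
  exists l : seq nat, [/\ uniq l, l =i level i & forall k, k < size l ->
                m (E.+1 + n + n + below i + k) = nth 0 l k] /\
    [/\ r 9 = E.+1 + n + n + below i,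
        r 13 = E.+1 + n + n + below i + size l,
        r 0 = untaken level_count i & r 15 = taken_before level_count i])).
- have below0 : below 0 = 0.
    by rewrite /below (eq_count (a2 := pred0)) ?count_pred0.
  split; first by split=> //; lia.
  exists [:: s]; split; last first.
    by split; rewrite ?below0 /untaken ?big_geq //=; lia.
  split=> // [v | [|//] _]; last by rewrite below0 !addn0.
  rewrite inE unfold_in /level; apply/eqP/andP => [-> | [lt_v]].
    by rewrite lay_eq0 // eqxx.
  by rewrite lay_eq0 // => /eqP.
- move=> i T {cr r0 r15 inm om mk r9 r13 ms}r {}m lt_i.
  case=> -[le_T cr inm om mk] [l [[ul el cells] [r9 r13 r0 r15]]].
  have [[_ _ r3 r4 _] [r6 r7]] := cr.
  have size_l := size_level ul el.
  have l_gt0 : 0 < size l by rewrite size_l level_count_gt0.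
  have lt_b := below_le i.+1; rewrite belowS -size_l in lt_b.
  have lt_T :
      T + 28 * \sum_(u <- l) (size (ad u)).+1 <= T0 + 28 * cost_below i.+1.
    rewrite cost_belowS (perm_big _ (perm_level ul el)) big_filter.
    by set c := \sum_(_ <- _ | _) _; lia.
  (* The level is nonempty, so its cells absorb the constant overhead of a round: this is why 28
     replaces 11. *)
  have sum_gt0 : 0 < \sum_(u <- l) (size (ad u)).+1.
    by case: (l) l_gt0 => // u l' _; rewrite big_cons.
  split; first by lia.
  do 2! (apply: vc_seq; split; first by rewrite /=; lia).
  set r1 := update _ 14 _.
  have sc : scanning i l pred0 r1 m.
    exists [::]; split=> //; first by rewrite /r1 /=; lia.
      by move=> k; rewrite addn0 cats0; apply: cells.
    by apply: eq_marks mk _ => v _; rewrite andbT.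
  apply: vc_seq; apply: reaches_weaken (scan_levelP T.+4 ul el (cr : consts r1)
    inm om sc r9 r13) => {cr inm om mk cells sc}T' r' m'.
  case=> -[le_T' cr inm om sc] [f0 f9 f13 f15 f16].
  rewrite /r1 /= in f0 f9 f13 f15 f16.
  have [l' [ul' el' r14 cells mk]] := sc; have [_ [r6' _]] := cr.
  have size_l' := size_level ul' el'.
  apply: vc_seq; apply: (@detect_takenP (taken level_count i)) => //.
    by rewrite takenE -size_l -size_l' f13 f15 f16 r14 r15 r13 r9; lia.
  move=> T2 r2 le_T2 fr r18.
  have fr0 := fr 0 isT; have fr6 := fr 6 isT; have fr9 := fr 9 isT.
  have fr14 := fr 14 isT.
  have cr2 : consts r2 by move: cr; rewrite /consts !fr.
  have lt_b' := below_le i.+2; rewrite !belowS -size_l -size_l' in lt_b'.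
  (* Each level scanned contains a vertex, so the counter in register 0 stays at most [n] and cannot
     overflow. *)
  have unt_le : untaken level_count i <= below i.
    elim: (i) (ltnW lt_i) => [|k IH] lt_k; first by rewrite /untaken big_geq.
    have := IH (ltnW lt_k); have := level_count_gt0 k.
    by rewrite untakenS belowS; lia.
  (* Both outcomes of the last test restore the invariant in this way. *)
  have nextI T3 r3' : T3 <= T2 + 4 -> consts r3' -> r3' 9 = r2 9 ->
      r3' 13 = r2 14 -> r3' 15 = r2 18 ->
      r3' 0 = untaken level_count i.+1 ->
      [/\ T3 <= T0 + 28 * cost_below i.+1, consts r3', input m', offsets m' n &
          marks m' (fun v => i.+1 < lay v)] /\
      exists l : seq nat, [/\ uniq l, l =i level i.+1 & forall k, k < size l ->
                    m' (E.+1 + n + n + below i.+1 + k) = nth 0 l k] /\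
        [/\ r3' 9 = E.+1 + n + n + below i.+1,
            r3' 13 = E.+1 + n + n + below i.+1 + size l,
            r3' 0 = untaken level_count i.+1 &
            r3' 15 = taken_before level_count i.+1].
    move=> le_T3 cr3 q9 q13 q15 q0; split.
      split=> //; first by lia.
      apply: eq_marks mk _ => v; rewrite inE /level => -> /=.
      by lia.
    exists l'; split; first split=> //.
      move=> k lt_k; have := cells (size l + k); rewrite ltn_add2l lt_k nth_cat.
      rewrite ifF ?addKn; last by lia.
      by rewrite belowS -size_l !addnA; apply.
    by split=> //=; rewrite ?belowS -?size_l; lia.
  split; first by rewrite r18; case: taken; lia.
  split=> /= [tk | ntk].
    do 2! (split; first by rewrite /= ?fr0 ?fr6 ?fr14; lia).
    by apply: nextI => //=; rewrite ?untakenS; lia.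
  split; first by rewrite /= fr14; lia.
  by apply: nextI => //=; rewrite ?untakenS; lia.
- move=> T {cr r0 r15 inm om mk r9 r13 ms}r {}m.
  case=> -[le_T cr inm om mk] [l [[ul el cells] [r9 r13 r0 r15]]].
  (* Level [t.+1] is empty, so the queue is exhausted and the loop stops. *)
  have := size_level ul el; have := level_count_gt0 t.+1; rewrite ltnn lt0n.
  have := cost_below_lt t.+1 => lt_E /negbFE/eqP -> size_l; split; first by lia.
  by split=> //; lia.
Qed.

Lemma broadcast_costP m : input m -> (forall a, E < a -> m a = 0) ->
  reaches w broadcast_cost (fun T r m' =>
      [/\ T <= 70 * E, consts r, input m' &
          r 0 = untaken level_count t.+1])
    0 (fun=> 0) m.
Proof.
move=> inm m0; have n_lt := off_gt n.
apply: reaches_seq (locate_arraysP inm) _ => T1 r1 _ [le1 cr1 r1_0 r1_15 ->].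
apply: reaches_seq (mark_headsP T1 cr1 r1_0 r1_15 inm m0) _ => T2 r2 m2.
case=> -[le2 cr2 r2_0 r2_15 inm2] [om2 mk2].
apply: reaches_seq (find_sourceP T2 cr2 r2_0 r2_15 inm2 om2 mk2) _ => T3 r3 m3.
case=> -[le3 cr3 r3_0 r3_15 inm3] [om3 mk3 r3_9 r3_13 ms].
apply: reaches_weaken
  (scan_levelsP T3 cr3 r3_0 r3_15 inm3 om3 mk3 r3_9 r3_13 ms).
by move=> T4 r4 m4 [le4 cr4 inm4 r4_0]; split=> //; lia.
Qed.

End Search.

(** * From encoded digraphs to the search *)

Lemma eq_untaken (sz sz' : nat -> nat) m : sz =1 sz' ->
  untaken sz m = untaken sz' m.
Proof.
move=> eq_sz; apply: eq_bigr => i _; congr (nat_of_bool (~~ _)).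
by elim: i => [|i IH]; rewrite !takenE !eq_sz //= IH.
Qed.

Lemma size_encoded_lists (ad : nat -> seq nat) k :
  (size (flatten [seq size (ad u) :: ad u | u <- iota 0 k])).+1 = off ad k.
Proof.
by rewrite size_flatten /shape -map_comp sumnE big_map /off /index_iota subn0.
Qed.

Lemma nth_encoded_list (ad : nat -> seq nat) n u k :
  u < n -> k <= size (ad u) ->
  nth 0 (n :: flatten [seq size (ad v) :: ad v | v <- iota 0 n])
    (off ad u + k) =
  nth 0 (size (ad u) :: ad u) k.
Proof.
move=> lt_u le_k; have -> : iota 0 n = iota 0 u ++ u :: iota u.+1 (n - u.+1).
  by rewrite -[u :: _]/(iota (0 + u) (n - u.+1).+1) -iotaD; congr iota; lia.
rewrite map_cat flatten_cat -cat_cons nth_cat /= size_encoded_lists.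
by rewrite ltnNge leq_addr /= addKn -cat_cons nth_cat /= ltnS le_k.
Qed.

(** One run serves both problems: [key], the cell after the encoding, is the bound for the decision
    problem and 0 for the optimisation problem. *)
Lemma broadcast_cost_run (D : digraph) (y : seq nat) (key w : nat)
    (m : nat -> nat) :
  single_sourced_layered_dag D -> encodes_digraph D y ->
  4 * size y + 4 < 2 ^ w -> key < 2 ^ w ->
  (forall a, a < size y -> m a = nth 0 y a) -> m (size y) = key ->
  (forall a, size y < a -> m a = 0) ->
  exists2 b, @is_answer minimum_broadcast_cost D b &
    reaches w broadcast_cost (fun T r m' =>
      [/\ T <= 70 * size y, r 2 = size y, m' (size y) = key & r 0 = b])
      0 (fun=> 0) m.
Proof.
move=> ssD [adj adjP def_y] lt_w lt_key my mkey m0.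
have [t [lay [lay_arc lay_pred sz0 sz_gt0]]] := single_sourced_levels ssD.
exists (untaken (level_size lay) t.+1).
  split=> [|f]; last exact: untaken_le_cost.
  exists (greedy_broadcast t lay); first exact: greedy_broadcast_dominating.
  exact: cost_greedy_broadcast.
pose n := order D.
(* The machine handles plain numbers, so lists and levels get default values at numbers that are not
   vertices. *)
pose ad u := if insub u is Some o then [seq val v | v <- adj o] else [::].
pose lay' u := if insub u is Some o then lay o else 0.
have adE (o : 'I_n) : ad o = [seq val v | v <- adj o] by rewrite /ad valK.
have layE (o : 'I_n) : lay' o = lay o by rewrite /lay' valK.
have count_lay : level_count n lay' =1 level_size lay.
  move=> i; rewrite /level_count -val_enum_ord count_map /level_size.
  rewrite -sum1_count big_enum_cond -sum1_card.
  by apply: eq_bigl => o; rewrite !inE /= layE.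
have {}def_y : y = n :: flatten [seq size (ad u) :: ad u | u <- iota 0 n].
  rewrite def_y -val_enum_ord -map_comp; congr (_ :: flatten _).
  by apply: eq_map => o; rewrite /= adE size_map.
have size_y : size y = off ad n by rewrite def_y /= size_encoded_lists.
have /eqP/fintype.card1P[s sE] := sz0.
have sP v : (lay v == 0) = (v == s) by have := sE v; rewrite !inE.
rewrite (eq_untaken _ (fsym count_lay)) size_y.
apply: reaches_weaken
  (@broadcast_costP w n s t key ad lay' _ _ _ _ _ _ _ m _ _).
- by move=> T r m' [le_T [[_ r2 _ _ _] _] [_ mE _ _] r0].
- move=> u v lt_u; rewrite -[u]/(val (Ordinal lt_u)) adE => /mapP[o].
  rewrite (adjP _).2 => uo ->; split; first exact: ltn_ord.
  by rewrite !layE (lay_arc _ _ uo).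
- move=> v lt_v; rewrite -[v]/(val (Ordinal lt_v)) layE => /lay_pred[u uv].
  by exists u => //; rewrite adE map_f // (adjP _).2.
- exact: ltn_ord.
- by move=> v lt_v; rewrite -[v]/(val (Ordinal lt_v)) layE sP.
- by move=> i; rewrite count_lay.
- by rewrite -size_y.
- exact: lt_key.
- split=> [||u lt_u|u k lt_u lt_k].
  + by rewrite my def_y.
  + by rewrite -size_y.
  + have := @nth_encoded_list ad n u 0 lt_u isT; rewrite -def_y addn0 /= => <-.
    by apply: my; rewrite size_y; have := off_end ad lt_u; lia.
  + have := @nth_encoded_list ad n u k.+1 lt_u lt_k; rewrite -def_y /= => <-.
    by apply: my; rewrite size_y; have := off_end ad lt_u; lia.
- by rewrite -size_y.
Qed.

Lemma word_size_bound (x : seq nat) w : 0 < size x ->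
  (size x + \max_(a <- x) a).+1 ^ 80 <= 2 ^ w ->
  4 * size x + 4 < 2 ^ w /\ forall a, a \in x -> a < 2 ^ w.
Proof.
set N := (_ + _).+1 => x_gt0 le_w.
have N_gt1 : 1 < N by rewrite /N; lia.
(* As [N] is at least 2, [N ^ 80] is at least [N * N ^ 3], hence at least [8 * N]. *)
have {le_w} le_N : 8 * N <= 2 ^ w.
  apply: leq_trans le_w; rewrite (expnS _ 79) mulnC leq_mul2l /N -/N.
  apply: (@leq_trans (N ^ 3)); first by rewrite (@leq_exp2r 2 N 3).
  by rewrite leq_pexp2l //; lia.
split; first by rewrite /N in le_N; lia.
move=> a ax; have le_a : a <= \max_(b <- x) b.
  exact: (leq_bigmax_seq (F := id)).
by apply: leq_trans le_N; rewrite /N; lia.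
Qed.

Theorem theorem6 :
  @linear_time_solvable_on broadcast_domination
    (fun Dk : digraph * nat => single_sourced_layered_dag Dk.1) /\
  @linear_time_solvable_on minimum_broadcast_cost
    (fun D : digraph => single_sourced_layered_dag D).
Proof.
split.
(* Computing the cost takes at most 70 steps per cell; 80 leaves room for the final comparison. *)
- exists (compile 0 broadcast_decision), 80 => -[D k] x w ssD [y yD ->] hw.
  have {hw}[|lt_w lt_x] := word_size_bound _ hw; first by rewrite size_rcons.
  rewrite size_rcons in lt_w *.
  have [|||||b [[f domf cost_f] min_b] run] :=
    @broadcast_cost_run D y k w (nth 0 (rcons y k)) ssD yD.
  + by lia.
  + by apply: lt_x; rewrite mem_rcons mem_head.
  + by move=> a lt_a; rewrite nth_rcons lt_a.
  + by rewrite nth_rcons ltnn eqxx.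
  + by move=> a lt_a; rewrite nth_default // size_rcons.
  exists (b <= k : nat).
    apply: reaches_outputs; apply: reaches_seq run _ => T r m.
    case=> le_T r2 mk r0; apply: vcP; rewrite /= r2 mk r0.
    have lt1 : 1 < 2 ^ w by lia.
    split; first by apply: lt_x; rewrite mem_rcons mem_head.
    by split=> h; split; lia.
  split; first by case: (b <= k).
  split=> [le_b | [g domg le_g]].
    by exists f => //; rewrite cost_f; case: leqP le_b.
  by rewrite (leq_trans (min_b g domg) le_g).
- exists (compile 0 broadcast_cost), 80 => D x w ssD xD hw.
  have x_gt0 : 0 < size x by rewrite (size_encoding xD).
  have {hw}[lt_w lt_x] := word_size_bound x_gt0 hw.
  have [|||||b ansb run] := @broadcast_cost_run D x 0 w (nth 0 x) ssD xD.
  + exact: lt_w.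
  + by rewrite expn_gt0.
  + by [].
  + by rewrite nth_default.
  + by move=> a lt_a; rewrite nth_default // ltnW.
  exists b => //; apply: reaches_outputs; apply: reaches_weaken run.
  by move=> T r m [le_T _ _ r0]; split=> //; lia.
Qed.
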